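(* Let $n,k\ge 1$, let $d=(d_1,\ldots,d_n)$ be a tuple of nonnegative integers, and let $F$ be either $\mathbb{C}$ or an algebraically closed field of characteristic $p>0$ with $p$ relatively prime to the nonzero $d_i$. Let $A=F[\sigma_1,\sigma_1^{-1},\ldots,\sigma_n,\sigma_n^{-1}]$ and $A_d=F[\sigma_1^{d_1},\sigma_1^{-d_1},\ldots,\sigma_n^{d_n},\sigma_n^{-d_n}]\subset A$. Let $Q$ be an $A_d$-submodule of $A_d^k$ and let $\mathcal{C}(Q)=\{P\subset A^k \text{ an } A\text{-submodule} : P\cap A_d^k=Q\}$. Then the set $\mathcal{C}(Q)$ is stable under the action of $\mathrm{Aut}_{A_d}(A)$. Furthermore, if all the $d_i$ are positive (i.e. the sublattice $\mathbb{L}_d=\{x\in\mathbb{Z}^n : x_i\in d_i\mathbb{Z}\ \forall i\}$ is of full rank), then the unique fixed point of this action on $\mathcal{C}(Q)$ is $Q^e$.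
   Context: $\mathrm{Aut}_{A_d}(A)$ is the group of $F$-algebra automorphisms of $A$ fixing every element of $A_d$. It acts on $A^k$ coordinatewise, $g(a_1,\ldots,a_k)=(g(a_1),\ldots,g(a_k))$, and hence on the collection of $A$-submodules of $A^k$ by $P\mapsto g(P)$. $Q^e$ denotes the extension of $Q$, i.e. the $A$-submodule of $A^k$ generated by $Q$. *)

(* Defs.v *)
From HB Require Import structures.
From mathcomp Require Import all_boot all_order all_algebra.
From mathcomp Require Import finmap.
From mathcomp.multinomials Require Import monalg.
From mathcomp Require Import boolp classical_sets reals complex.

Set Implicit Arguments.
Unset Strict Implicit.
Unset Printing Implicit Defensive.

Import GRing.Theory.

Local Open Scope classical_set_scope.
Local Open Scope ring_scope.

(* The Laurent polynomial ring F[sigma_1^{+-1}, ..., sigma_n^{+-1}]: finitely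
   supported functions from the exponent lattice Z^n to F with the convolution
   product. The library puts this product on {malg F[K]} only for monoids K
   without nontrivial units (monomType), which excludes Z^n. *)
Definition laurent (F : fieldType) (n : nat) : Type := {malg F['rV[int]_n]}.

(* Prop-valued counterpart of GRing.subalg_closed. *)
Definition is_subalg (F : fieldType) (A : algType F) (S : set A) : Prop :=
  [/\ S 1,
      forall (c : F) u v, S u -> S v -> S (c *: u + v) &
      forall u v, S u -> S v -> S (u * v)].

Section Laurent.
Context (F : fieldType) (n : nat).

HB.instance Definition _ := GRing.Lmodule.on (laurent F n).

Implicit Types (f g h : laurent F n) (m : 'rV[int]_n).

Definition laurent_monomial m : laurent F n := << m >>.

Definition laurent_one : laurent F n := laurent_monomial 0.

Definition laurent_mul f g : laurent F n :=
  \sum_(m1 <- msupp f) \sum_(m2 <- msupp g) << f@_m1 * g@_m2 *g m1 + m2 >>.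

Lemma laurent_mulw (d1 d2 : {fset 'rV[int]_n}) f g :
  (msupp f `<=` d1)%fset -> (msupp g `<=` d2)%fset ->
  laurent_mul f g =
    \sum_(m1 <- d1) \sum_(m2 <- d2) << f@_m1 * g@_m2 *g m1 + m2 >>.
Proof.
move=> le_d1 le_d2; rewrite /laurent_mul (big_fset_incl _ le_d1) /=.
  apply/eq_bigr=> m1 _; apply/big_fset_incl => // m _ /mcoeff_outdom ->.
  by rewrite mulr0 monalgU0.
move=> m _ /mcoeff_outdom fm.
by rewrite big1 => // m' _; rewrite fm mul0r monalgU0.
Qed.

Lemma laurent_mulC : commutative laurent_mul.
Proof.
move=> f g; rewrite /laurent_mul exchange_big /=.
by apply: eq_bigr=> m1 _; apply: eq_bigr=> m2 _; rewrite mulrC addrC.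
Qed.

Lemma laurent_mul0g : left_zero 0 laurent_mul.
Proof. by move=> g; rewrite /laurent_mul msupp0 big_seq_fset0. Qed.

Lemma laurent_mulDl : left_distributive laurent_mul +%R.
Proof.
move=> f g h.
have lef := fsubsetUl (msupp f) (msupp g).
have leg := fsubsetUr (msupp f) (msupp g).
rewrite (laurent_mulw lef (fsubset_refl (msupp h))).
rewrite (laurent_mulw leg (fsubset_refl (msupp h))).
rewrite (laurent_mulw (msuppD_le f g) (fsubset_refl (msupp h))).
rewrite -big_split /=; apply/eq_bigr=> m1 _.
rewrite -big_split /=; apply/eq_bigr=> m2 _.
by rewrite mcoeffD mulrDl monalgUD.
Qed.

Lemma laurent_mulUg c m g :
  laurent_mul << c *g m >> g = \sum_(m' <- msupp g) << c * g@_m' *g m + m' >>.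
Proof.
rewrite (laurent_mulw msuppU_le (fsubset_refl _)) big_seq_fset1.
by apply/eq_bigr => m' _; rewrite mcoeffUU.
Qed.

Lemma laurent_mulUU c1 c2 m1 m2 :
  laurent_mul << c1 *g m1 >> << c2 *g m2 >> = << c1 * c2 *g m1 + m2 >>.
Proof.
by rewrite (laurent_mulw msuppU_le msuppU_le) !big_seq_fset1 !mcoeffUU.
Qed.

Lemma laurent_mul_suml (I : Type) (r : seq I) (G : I -> laurent F n) g :
  laurent_mul (\sum_(i <- r) G i) g = \sum_(i <- r) laurent_mul (G i) g.
Proof.
exact: (big_morph (laurent_mul^~ g) (fun x y => laurent_mulDl x y g)
          (laurent_mul0g g)).
Qed.

Lemma laurent_mul_sumr (I : Type) (r : seq I) (G : I -> laurent F n) g :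
  laurent_mul g (\sum_(i <- r) G i) = \sum_(i <- r) laurent_mul g (G i).
Proof.
by rewrite laurent_mulC laurent_mul_suml; apply: eq_bigr => i _;
  rewrite laurent_mulC.
Qed.

Lemma laurent_mulA : associative laurent_mul.
Proof.
move=> f g h; rewrite [f]monalgE (laurent_mul_suml _ _ (laurent_mul g h)).
rewrite (laurent_mul_suml _ _ g) (laurent_mul_suml _ _ h).
apply: eq_bigr => m1 _; rewrite [g]monalgE (laurent_mul_suml _ _ h).
rewrite !(laurent_mul_sumr _ _ << _ *g m1 >>) (laurent_mul_suml _ _ h).
apply: eq_bigr => m2 _; rewrite [h]monalgE.
rewrite (laurent_mul_sumr _ _ << _ *g m2 >>).
rewrite (laurent_mul_sumr _ _ << _ *g m1 >>).
rewrite (laurent_mul_sumr _ _ (laurent_mul _ _)).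
by apply: eq_bigr => m3 _; rewrite !laurent_mulUU mulrA addrA.
Qed.

Lemma laurent_mul1g : left_id laurent_one laurent_mul.
Proof.
move=> g; rewrite laurent_mulUg [RHS]monalgE.
by apply/eq_bigr=> m _; rewrite mul1r add0r.
Qed.

Lemma laurent_one_neq0 : laurent_one != 0.
Proof. by rewrite monalgU_eq0 oner_eq0. Qed.

HB.instance Definition _ := GRing.Zmodule_isComNzRing.Build (laurent F n)
  laurent_mulA laurent_mulC laurent_mul1g laurent_mulDl laurent_one_neq0.

Lemma laurent_scaleAl c f g : c *: (f * g) = (c *: f) * g.
Proof.
have mulUE b h : laurent_mul << b *g 0 >> h = b *: h.
  apply/malgP=> m; rewrite mcoeffZ laurent_mulUg.
  rewrite [in RHS](monalgE h) !raddf_sum mulr_sumr /=.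
  by apply: eq_bigr => m' _; rewrite add0r !mcoeffU mulrnAr.
rewrite -(mulUE c (f * g)) -(mulUE c f); exact: laurent_mulA.
Qed.

HB.instance Definition _ :=
  GRing.Lmodule_isLalgebra.Build F (laurent F n) laurent_scaleAl.
HB.instance Definition _ :=
  GRing.Lalgebra_isComAlgebra.Build F (laurent F n).

Definition sigma (i : 'I_n) : laurent F n := laurent_monomial (delta_mx 0 i).
Definition sigmaV (i : 'I_n) : laurent F n :=
  laurent_monomial (- delta_mx 0 i).

Lemma sigmaK i : sigma i * sigmaV i = 1.
Proof. by rewrite /GRing.mul /= laurent_mulUU mulr1 subrr. Qed.

(* F[sigma_1^{+-d_1}, ..., sigma_n^{+-d_n}], as the generated subalgebra. *)
Definition laurent_sub (d : 'I_n -> nat) : set (laurent F n) :=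
  smallest (@is_subalg F (laurent F n))
    [set a | exists i, a = sigma i ^+ d i \/ a = sigmaV i ^+ d i].

End Laurent.

Section Submodules.
Context (F : fieldType) (A : comAlgType F) (k : nat).

Definition free_mod (B : set A) : set 'rV[A]_k :=
  [set v | forall j, B (v 0 j)].

Definition is_submod (B : set A) (M : set 'rV[A]_k) : Prop :=
  [/\ M 0,
      forall u v, M u -> M v -> M (u + v) &
      forall b v, B b -> M v -> M (b *: v)].

Definition extension (Q : set 'rV[A]_k) : set 'rV[A]_k :=
  smallest (is_submod setT) Q.

(* The set C(Q) of submodules P of A^k whose intersection with B^k is Q. *)
Definition contracts_to (B : set A) (Q : set 'rV[A]_k) :
    set (set 'rV[A]_k) :=
  [set P | is_submod setT P /\ P `&` free_mod B = Q].

Definition Aut_fixing (B : set A) : set {lrmorphism A -> A} :=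
  [set g : {lrmorphism A -> A} | bijective g /\ forall b, B b -> g b = b].

Definition submod_act (g : {lrmorphism A -> A}) (P : set 'rV[A]_k) :
    set 'rV[A]_k :=
  [set map_mx g v | v in P].

End Submodules.

(* A realType is a complete ordered field, so R[i] is the complex field. *)
Definition is_complex_field (F : fieldType) : Prop :=
  exists (R : realType) (f : {rmorphism R[i] -> F}), bijective f.

(* Main.v *)
(** The projection of [A] onto [A_d] that kills the monomials outside the
    lattice [L_d] is [A_d]-linear; applying it to a combination of elements of
    [Q] with coefficients in [A] shows that [Q^e] contracts to [Q].
    If a submodule [P] is fixed by the automorphisms
    [sigma_i |-> z * sigma_i], [z ^+ d_i = 1], then averaging over the
    characters of [Z^n / L_d] shows that [P] contains, for each of its
    elements [v], the part [v_c] of [v] supported on a coset [c + L_d]. Since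
    [sigma^-c v_c] lies in [P] and has coordinates in [A_d], it lies in [Q],
    so [v], the sum of the [v_c], is in [Q^e]. *)
From HB Require Import structures.
Require Import Defs.
From mathcomp Require Import all_boot all_order all_algebra all_field.
From mathcomp Require Import finmap.
From mathcomp.multinomials Require Import monalg.
From mathcomp Require Import classical_sets complex reals.

Set Implicit Arguments.
Unset Strict Implicit.
Unset Printing Implicit Defensive.

Import Order.TTheory GRing.Theory Num.Theory.

Local Open Scope classical_set_scope.
Local Open Scope ring_scope.

(** * Automorphisms acting on submodules; extension and contraction *)

Section SubmoduleAction.
Context (F : fieldType) (A : comAlgType F) (k : nat).
Implicit Types (B : set A) (P Q : set 'rV[A]_k) (g : {lrmorphism A -> A}).

Lemma submod_act_submod g P :
  bijective g -> is_submod setT P -> is_submod setT (submod_act g P).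
Proof.
move=> [h hK gK] [P0 PD PZ]; split.
- by exists 0 => //; rewrite map_mx0.
- move=> _ _ [u Pu <-] [v Pv <-]; exists (u + v); first exact: PD.
  by rewrite map_mxD.
(* [map_mx g] is only semilinear, so the scalar is pulled back along the inverse [h]. *)
move=> b _ _ [v Pv <-]; exists (h b *: v); first exact: PZ.
by rewrite map_mxZ /= gK.
Qed.

Lemma submod_act_contracts B Q g P :
  Q `<=` free_mod B -> Aut_fixing B g -> contracts_to B Q P ->
  contracts_to B Q (submod_act g P).
Proof.
move=> QB [bij_g gB] [subP PQ].
have fixB (v : 'rV[A]_k) : free_mod B v -> map_mx g v = v.
  by move=> Bv; apply/rowP => j; rewrite mxE gB.
split; first exact: submod_act_submod.
rewrite -PQ; apply/seteqP; split=> [_ [[v Pv <-] Bgv]|v [Pv Bv]].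
  (* As [g v] has coordinates in [B], [g (g v) = g v]; injectivity of [g] gives [g v = v]. *)
  have gvv : map_mx g v = v.
    have := fixB _ Bgv; case: bij_g => h hK _ /rowP eqg; apply/rowP => j.
    by apply: (can_inj hK); have := eqg j; rewrite !mxE.
  by rewrite gvv in Bgv *.
by split=> //; exists v => //; rewrite fixB.
Qed.

Lemma extension_submod Q : is_submod setT (extension Q).
Proof.
split.
- by move=> M [[]].
- by move=> u v Eu Ev M [sM QM]; case: (sM) => _ MD _; apply: MD;
    [apply: Eu | apply: Ev].
- by move=> b v _ Ev M [sM QM]; case: (sM) => _ _ MZ; apply: MZ => //;
    apply: Ev.
Qed.

Lemma sub_extension Q : Q `<=` extension Q.
Proof. by move=> v Qv M [_ QM]; apply: QM. Qed.

Lemma extension_sub Q M : is_submod setT M -> Q `<=` M -> extension Q `<=` M.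
Proof. by move=> sM QM v; apply; split. Qed.

(** Since [g] fixes [Q] pointwise, both the preimage of [extension Q] under [g] and its image are
    submodules containing [Q]; minimality gives the two inclusions. *)
Lemma submod_act_extension B Q g :
  Q `<=` free_mod B -> Aut_fixing B g ->
  submod_act g (extension Q) = extension Q.
Proof.
move=> QB [bij_g gB].
have fixQ v : Q v -> map_mx g v = v.
  by move=> /QB Bv; apply/rowP => j; rewrite mxE gB.
have [E0 ED EZ] := extension_submod Q.
apply/seteqP; split=> [_ [v Ev <-]|].
  apply: (extension_sub (M := [set v | extension Q (map_mx g v)])) v Ev.
    split=> /=; first by rewrite map_mx0.
    - by move=> u v Eu Ev; rewrite map_mxD; apply: ED.
    - by move=> b v _ Ev; rewrite map_mxZ; apply: EZ.
  by move=> v Qv /=; rewrite fixQ //; apply: sub_extension.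
apply: extension_sub; first exact/submod_act_submod/extension_submod.
by move=> v Qv; exists v; [exact: sub_extension | exact: fixQ].
Qed.

Lemma extension_contracts B Q (pi : {additive A -> A}) :
  (forall a, B (pi a)) -> (forall b, B b -> pi b = b) ->
  (forall a b, B b -> pi (a * b) = pi a * b) ->
  is_submod B Q -> Q `<=` free_mod B -> contracts_to B Q (extension Q).
Proof.
move=> piB piK piM [Q0 QD QZ] QB; split; first exact: extension_submod.
apply/seteqP; split=> [v [Ev Bv]|v Qv]; last first.
  by split; [exact: sub_extension | exact: QB].
(* Quantifying over all multiples [a *: v] makes this set an [A]-submodule, although [pi] is only
   [B]-linear. *)
suff /(_ v Ev 1) : extension Q `<=` [set v | forall a, Q (map_mx pi (a *: v))].
  rewrite scale1r; suff -> : map_mx pi v = v by [].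
  by apply/rowP => j; rewrite mxE piK.
apply: extension_sub => [|u Qu a].
  split=> /=.
  - by move=> a; rewrite scaler0 map_mx0.
  - by move=> u w Qu Qw a; rewrite scalerDr map_mxD; apply: QD.
  - by move=> b u _ Qu a; rewrite scalerA.
suff -> : map_mx pi (a *: u) = pi a *: u by apply: QZ.
by apply/rowP => j; rewrite !mxE piM //; apply: QB.
Qed.

End SubmoduleAction.

(** * Primitive roots of unity and orthogonality of characters *)

Section RootsOfUnity.
Context (F : closedFieldType).

(** If [d] is nonzero in [F], then ['X^d - 1] is separable and has [d] distinct roots; that many
    [d]-th roots of unity in a field include a primitive one. *)
Lemma closed_prim_root_exists d :
  d%:R != 0 :> F -> exists z : F, d.-primitive_root z.
Proof.
move=> dF; have d_gt0 : (0 < d)%N by case: d dF => //; rewrite eqxx.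
pose p : {poly F} := 'X^d - 1.
have [r Dp] := closed_field_poly_normal p.
have lp : lead_coef p = 1 by apply/monicP; rewrite monicXnsubC.
rewrite lp scale1r in Dp.
have/hasP[z _ pz] : has d.-primitive_root r.
  apply: cyclic.has_prim_root => //.
  - by apply/allP => z zr; rewrite /root_of_unity -/p Dp root_prod_XsubC.
  - by rewrite -separable_prod_XsubC -Dp cyclotomic.separable_Xn_sub_1.
  - by rewrite -ltnS -(size_prod_XsubC _ id) -Dp size_XnsubC.
by exists z.
Qed.

Lemma prim_exprz_eq1 d (z : F) (x : int) :
  d.-primitive_root z -> (z ^ x == 1) = (d%:Z %| x)%Z.
Proof.
move=> pz; rewrite dvdzE; case: x => m /=; first by rewrite (prim_order_dvd pz).
by rewrite NegzE -exprnN invr_eq1 (prim_order_dvd pz).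
Qed.

Lemma sum_prim_exprz d (z : F) (x : int) :
  d.-primitive_root z ->
  \sum_(j < d) (z ^+ j) ^ x = if (d%:Z %| x)%Z then d%:R else 0.
Proof.
move=> pz; rewrite -(prim_exprz_eq1 x pz).
rewrite (eq_bigr (fun j : 'I_d => (z ^ x) ^+ j)) => [|j _]; last first.
  by rewrite !exprnP !exprz_exp mulrC.
have [->|y1] := eqVneq.
  by under eq_bigr do rewrite expr1n; rewrite sumr_const card_ord.
(* Geometric sum: multiplied by [z ^ x - 1], it becomes [(z ^ x) ^+ d - 1 = 0]. *)
apply: (mulfI (x := z ^ x - 1)); first by rewrite subr_eq0.
rewrite mulr0 -subrX1 exprnP exprz_exp mulrC -exprz_exp -exprnP.
by rewrite (prim_expr_order pz) exp1rz subrr.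
Qed.

End RootsOfUnity.

(** * Operators diagonal in the monomial basis *)

(* Locked, since unification otherwise unfolds Laurent polynomials down to
   finitely supported functions. *)
HB.lock Definition laurent_term (F : fieldType) (n : nat) (c : F)
    (m : 'rV[int]_n) : laurent F n := << c *g m >>.

HB.lock Definition laurent_coeff (F : fieldType) (n : nat)
    (m : 'rV[int]_n) (f : laurent F n) : F := f@_m.

Arguments laurent_term {F n}.
Arguments laurent_coeff {F n}.

(** With [w] a character of the exponent lattice this is an algebra automorphism; with [w] an
    indicator function it is a projection onto a span of monomials. *)
HB.lock Definition multiplier (F : fieldType) (n : nat)
    (w : 'rV[int]_n -> F) (f : laurent F n) : laurent F n :=
  \sum_(m <- msupp f) laurent_term (w m * laurent_coeff m f) m.

Arguments multiplier {F n}.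

Section Multipliers.
Context (F : fieldType) (n : nat).
Implicit Types (c : F) (f g : laurent F n) (m : 'rV[int]_n).
Implicit Types (w : 'rV[int]_n -> F).

Lemma laurent_coeff_is_linear m : scalar (@laurent_coeff F n m).
Proof. by move=> c f g; rewrite laurent_coeff.unlock mcoeffD mcoeffZ. Qed.

HB.instance Definition _ m :=
  GRing.isLinear.Build F (laurent F n) F *%R (@laurent_coeff F n m)
    (laurent_coeff_is_linear m).

Lemma laurent_coeff_term m c m' :
  laurent_coeff m (laurent_term c m') = if m' == m then c else 0.
Proof.
by rewrite laurent_coeff.unlock laurent_term.unlock mcoeffU; case: eqP.
Qed.

Lemma laurent_coeffP f g :
  (forall m, laurent_coeff m f = laurent_coeff m g) -> f = g.
Proof. by rewrite laurent_coeff.unlock => ?; apply/malgP. Qed.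

Lemma laurent_sum_terms f :
  f = \sum_(m <- msupp f) laurent_term (laurent_coeff m f) m.
Proof. rewrite laurent_coeff.unlock laurent_term.unlock; exact: monalgE. Qed.

Lemma laurent_termZ c1 c2 m :
  laurent_term (c1 * c2) m = c1 *: laurent_term c2 m.
Proof.
apply/laurent_coeffP => m'; rewrite linearZ /= !laurent_coeff_term.
by case: eqP; rewrite ?mulr0.
Qed.

Lemma laurent_term1 : laurent_term 1 0 = 1 :> laurent F n.
Proof. by rewrite laurent_term.unlock. Qed.

Lemma laurent_termM c1 c2 m1 m2 :
  laurent_term c1 m1 * laurent_term c2 m2 = laurent_term (c1 * c2) (m1 + m2).
Proof. rewrite laurent_term.unlock; exact: laurent_mulUU. Qed.

Lemma coeff_multiplier w m f :
  laurent_coeff m (multiplier w f) = w m * laurent_coeff m f.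
Proof.
rewrite multiplier.unlock raddf_sum /= [in RHS](laurent_sum_terms f).
rewrite raddf_sum mulr_sumr /=; apply: eq_bigr => m' _.
rewrite 2!laurent_coeff_term.
by have [->|_] := eqVneq m' m; last rewrite mulr0.
Qed.

Lemma multiplier_is_linear w : linear (multiplier w).
Proof.
move=> c f g; apply/laurent_coeffP => m.
by rewrite linearP /= 3!coeff_multiplier linearP /= mulrDr mulrCA.
Qed.

HB.instance Definition _ w :=
  GRing.isLinear.Build F (laurent F n) (laurent F n) *:%R (multiplier w)
    (multiplier_is_linear w).

Lemma multiplier_term w c m :
  multiplier w (laurent_term c m) = laurent_term (w m * c) m.
Proof.
apply/laurent_coeffP => m'; rewrite coeff_multiplier !laurent_coeff_term.
by have [->|_] := eqVneq m m'; last rewrite mulr0.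
Qed.

Lemma multiplierM w : {morph w : m1 m2 / m1 + m2 >-> m1 * m2} ->
  {morph multiplier w : f g / f * g}.
Proof.
move=> wD f g; rewrite [f]laurent_sum_terms [g]laurent_sum_terms.
rewrite mulr_suml !raddf_sum mulr_suml /=; apply: eq_bigr => m1 _.
rewrite !mulr_sumr raddf_sum /=; apply: eq_bigr => m2 _.
by rewrite !multiplier_term !laurent_termM multiplier_term wD mulrACA.
Qed.

Lemma multiplier_automorphism w :
  w 0 = 1 -> {morph w : m1 m2 / m1 + m2 >-> m1 * m2} ->
  exists2 g : {lrmorphism laurent F n -> laurent F n},
    bijective g & g =1 multiplier w.
Proof.
move=> w0 wD.
have mM : monoid_morphism (multiplier w).
  split; last exact: multiplierM.
  by rewrite -laurent_term1 multiplier_term w0 mulr1.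
pose mMi := GRing.isMonoidMorphism.Build _ _ (multiplier w) mM.
pose g : {lrmorphism laurent F n -> laurent F n} :=
  HB.pack (multiplier w) mMi.
(* The inverse is the multiplier of the inverse character, [w (- m)] being the inverse of [w m]. *)
exists g => //; exists (multiplier (fun m => w (- m))) => f;
  apply/laurent_coeffP => m;
  by rewrite !coeff_multiplier mulrA -wD ?addNr ?subrr w0 mul1r.
Qed.

Lemma coeff_mul_term m' c m f :
  laurent_coeff m' (laurent_term c m * f) = c * laurent_coeff (m' - m) f.
Proof.
rewrite {1}[f]laurent_sum_terms mulr_sumr raddf_sum /=.
rewrite [in RHS](laurent_sum_terms f) raddf_sum mulr_sumr /=.
apply: eq_bigr => m2 _; rewrite laurent_termM 2!laurent_coeff_term.
by rewrite (eq_sym m2) subr_eq addrC eq_sym; case: eqP; rewrite ?mulr0.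
Qed.

End Multipliers.

(** * The subalgebra [A_d] and the projections onto cosets of its lattice *)

Section Lattice.
Context (F : fieldType) (n : nat) (d : 'I_n -> nat).
Implicit Types (f g : laurent F n) (m : 'rV[int]_n).

Lemma laurent_monomialE m : laurent_monomial F m = laurent_term 1 m.
Proof. by rewrite laurent_term.unlock. Qed.

(** Only 0 is divisible by 0, so [d i = 0] forces the [i]-th exponent to vanish, in agreement with
    [sigma i ^+ 0 = 1]. *)
Definition in_lattice m : bool := [forall i, (d i %| m 0%R i)%Z].

Lemma in_lattice0 : in_lattice 0.
Proof. by apply/forallP => i; rewrite mxE. Qed.

Lemma in_latticeN m : in_lattice (- m) = in_lattice m.
Proof. by apply: eq_forallb => i; rewrite mxE rpredN. Qed.

Lemma in_latticeDr m1 m2 :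
  in_lattice m2 -> in_lattice (m1 + m2) = in_lattice m1.
Proof.
move=> /forallP L2; apply: eq_forallb => i.
by rewrite mxE rpredDr.
Qed.

Lemma in_lattice_delta i : in_lattice (delta_mx 0 i *+ d i).
Proof.
apply/forallP => j; rewrite mulmxnE mxE eqxx /=.
have [->|_] := eqVneq j i; last by rewrite mulr0n mul0rn dvdz0.
by rewrite mulr1n natz dvdzz.
Qed.

Lemma laurent_monomialD m1 m2 :
  laurent_monomial F (m1 + m2) = laurent_monomial F m1 * laurent_monomial F m2.
Proof. by rewrite !laurent_monomialE laurent_termM mulr1. Qed.

Lemma laurent_monomialMn m j :
  laurent_monomial F (m *+ j) = laurent_monomial F m ^+ j.
Proof.
elim: j => [|j IHj]; first by rewrite laurent_monomialE laurent_term1.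
by rewrite mulrS exprS laurent_monomialD IHj.
Qed.

Lemma laurent_sub_subalg : is_subalg (laurent_sub (F := F) d).
Proof.
split.
- by move=> S [[]].
- by move=> c u v Lu Lv S sS; case: (sS) => -[_ SD _] _; apply: SD;
    [apply: Lu | apply: Lv].
- by move=> u v Lu Lv S sS; case: (sS) => -[_ _ SM] _; apply: SM;
    [apply: Lu | apply: Lv].
Qed.

(** Induction principle for [A_d]: its generators are themselves monomials with exponent in the
    lattice. *)
Lemma laurent_sub_ind (S : set (laurent F n)) :
  is_subalg S -> (forall m, in_lattice m -> S (laurent_monomial F m)) ->
  laurent_sub d `<=` S.
Proof.
move=> sS Sm f; apply; split=> // _ [i [->|->]].
  by rewrite -laurent_monomialMn; apply/Sm/in_lattice_delta.
rewrite -laurent_monomialMn mulNrn; apply: Sm.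
by rewrite in_latticeN in_lattice_delta.
Qed.

Lemma laurent_sub_monomial m :
  in_lattice m -> laurent_sub d (laurent_monomial F m).
Proof.
move=> /forallP Lm; have [B1 _ BM] := laurent_sub_subalg.
(* Nonnegative [e] uses powers of [sigma i ^+ d i], negative [e] powers of [sigmaV i ^+ d i]. *)
have Bgen i e :
    laurent_sub d (laurent_monomial F (delta_mx 0 i *~ (e * (d i)%:Z))).
  rewrite mulrC mulrzA -pmulrn; case: e => e.
    rewrite -pmulrn laurent_monomialMn.
    elim: e => [|e IHe]; first exact: B1.
    rewrite exprS; apply: BM; last exact: IHe.
    by move=> S [_]; apply; exists i; left; rewrite laurent_monomialMn.
  rewrite NegzE mulrNz -pmulrn -mulNrn laurent_monomialMn.
  elim: e.+1 => [|e' IHe]; first exact: B1.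
  rewrite exprS; apply: BM; last exact: IHe.
  by move=> S [_]; apply; exists i; right; rewrite -mulNrn laurent_monomialMn.
have -> : m = \sum_i delta_mx 0 i *~ m 0 i.
  rewrite {1}[m]row_sum_delta; apply: eq_bigr => i _.
  by rewrite -scaler_int intz.
elim/big_ind: _ => [|u v Bu Bv|i _].
- by rewrite laurent_monomialE laurent_term1; apply: B1.
- by rewrite laurent_monomialD; apply: BM.
by rewrite -(divzK (Lm i)); apply: Bgen.
Qed.

Lemma laurent_sub_supported f :
  (forall m, laurent_coeff m f != 0 -> in_lattice m) -> laurent_sub d f.
Proof.
move=> Lf; have [B1 BZ BM] := laurent_sub_subalg.
have B0 : laurent_sub d (0 : laurent F n).
  by rewrite -(addNr 1) -scaleN1r; apply: BZ.
rewrite [f]laurent_sum_terms; elim/big_ind: _ => [|u v Bu Bv|m _].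
- exact: B0.
- by rewrite -[u]scale1r; apply: BZ.
have [->|/Lf Lm] := eqVneq (laurent_coeff m f) 0.
  by rewrite -(mul0r 0) laurent_termZ scale0r; apply: B0.
rewrite -[laurent_coeff m f]mulr1 laurent_termZ -[X in laurent_sub _ X]addr0.
by apply: BZ => //; rewrite -laurent_monomialE; apply: laurent_sub_monomial.
Qed.

(** This sends [v] to its part [v_c] supported on [c + L_d]; [c = 0] gives the projection onto
    [A_d]. *)
Definition lattice_proj c : laurent F n -> laurent F n :=
  multiplier (fun m => (in_lattice (m - c))%:R).
HB.instance Definition _ c := GRing.Linear.on (lattice_proj c).

Lemma coeff_lattice_proj c m f :
  laurent_coeff m (lattice_proj c f) =
  (in_lattice (m - c))%:R * laurent_coeff m f.
Proof. exact: coeff_multiplier. Qed.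

(** Multiplication by a lattice monomial shifts exponents by an element of [L_d], which preserves
    each coset. *)
Lemma lattice_proj_mul_monomial m f : in_lattice m ->
  lattice_proj 0 (f * laurent_monomial F m) =
  lattice_proj 0 f * laurent_monomial F m.
Proof.
move=> Lm; apply/laurent_coeffP => m'; rewrite laurent_monomialE.
rewrite [f * _]mulrC [RHS](congr1 _ (mulrC _ _)).
rewrite [LHS]coeff_lattice_proj [in LHS]coeff_mul_term.
rewrite [RHS]coeff_mul_term [in RHS]coeff_lattice_proj !mul1r !subr0.
by rewrite -[in RHS](in_latticeDr (m' - m) Lm) subrK.
Qed.

Lemma lattice_projM f b : laurent_sub d b ->
  lattice_proj 0 (f * b) = lattice_proj 0 f * b.
Proof.
(* [f] stays general because the product case applies the hypothesis on [v] to [f * u]. *)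
move=> Bb; move: b Bb f; apply: laurent_sub_ind.
  split=> /=.
  - by move=> f; rewrite [f * 1]mulr1 [RHS]mulr1.
  - move=> c u v Hu Hv f.
    rewrite [RHS]mulrDr -(scalerAr c (lattice_proj 0 f) u) -(Hu f) -(Hv f).
    by rewrite -[RHS]linearP [f * (_ + _)]mulrDr -(scalerAr c f u).
  - move=> u v Hu Hv f.
    by rewrite [f * _]mulrA [RHS]mulrA -(Hu f) -(Hv (f * u)).
by move=> m Lm f; apply: lattice_proj_mul_monomial.
Qed.

(** By [A_d]-linearity applied to [1 * b], it is enough that 1 is fixed. *)
Lemma lattice_proj_id b : laurent_sub d b -> lattice_proj 0 b = b.
Proof.
move=> Bb; rewrite -{1}[b]mul1r (lattice_projM 1 Bb).
suff -> : lattice_proj 0 1 = 1 by rewrite mul1r.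
rewrite -laurent_term1 [LHS]multiplier_term.
by rewrite subr0 in_lattice0 mul1r.
Qed.

Lemma lattice_proj_sub f : laurent_sub d (lattice_proj 0 f).
Proof.
apply: laurent_sub_supported => m; rewrite coeff_multiplier subr0.
by case: (in_lattice m) => //; rewrite mul0r eqxx.
Qed.

(** A character trivial on [L_d] fixes the lattice monomials, and the fixed points of an algebra
    morphism form a subalgebra. *)
Lemma multiplier_fixes (w : 'rV[int]_n -> F) b :
  (forall m, in_lattice m -> w m = 1) -> laurent_sub d b ->
  {morph w : m1 m2 / m1 + m2 >-> m1 * m2} -> multiplier w b = b.
Proof.
move=> w1 + wD; move: b; apply: laurent_sub_ind => [|m Lm] /=; last first.
  by rewrite laurent_monomialE multiplier_term w1 ?mul1r.
split=> /=.
- by rewrite -laurent_term1 multiplier_term w1 ?mul1r ?in_lattice0.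
- by move=> c u v Hu Hv; rewrite linearP /= Hu Hv.
- by move=> u v Hu Hv; rewrite (multiplierM wD u v) Hu Hv.
Qed.

End Lattice.

(** * Splitting a vector along the cosets of the lattice *)

Section Decomposition.
Context (F : fieldType) (n : nat) (d : 'I_n -> nat).
Implicit Types (m : 'rV[int]_n).

(** A canonical representative of the coset [m + L_d]; reduction modulo 0 leaves a coordinate
    unchanged. *)
Definition residues m : 'rV[int]_n := \row_i (m 0%R i %% d i)%Z.

Lemma in_latticeB_residues m1 m2 :
  in_lattice d (m1 - residues m2) = (residues m1 == residues m2).
Proof.
apply/forallP/eqP => [L|eqr i]; last first.
  move/rowP/(_ i): eqr; rewrite !mxE => eqr.
  by rewrite -eqz_mod_dvd modz_mod eqr.
apply/rowP => i; have := L i; rewrite !mxE -eqz_mod_dvd modz_mod.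
by move/eqP.
Qed.

Lemma sum_lattice_proj k (v : 'rV[laurent F n]_k) :
  exists r : seq 'rV[int]_n,
    v = \sum_(c <- r) map_mx (@lattice_proj F n d c) v.
Proof.
(* All exponents occurring in [v]. Removing duplicate residues lists each coset once, so exactly one
   projection keeps a given monomial. *)
pose s := flatten [seq enum_fset (msupp (v 0 j)) | j <- enum 'I_k].
exists (undup (map residues s)); apply/rowP => j; apply/laurent_coeffP => m.
rewrite summxE raddf_sum /=.
under eq_bigr do rewrite mxE coeff_multiplier.
have [->|vm] := eqVneq (laurent_coeff m (v 0 j)) 0.
  by rewrite big1 // => c _; rewrite mulr0.
have rm : residues m \in undup (map residues s).
  rewrite mem_undup; apply/map_f/flattenP; exists (enum_fset (msupp (v 0 j))).
    by apply/map_f/mem_enum.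
  by rewrite -[_ \in _]mcoeff_neq0; rewrite laurent_coeff.unlock in vm.
rewrite (bigD1_seq (residues m)) ?undup_uniq //= in_latticeB_residues eqxx.
rewrite mul1r big_seq_cond big1 ?addr0 // => c /andP[+ ne].
rewrite mem_undup => /mapP[m' _ Dc]; rewrite Dc in ne *.
by rewrite in_latticeB_residues eq_sym (negPf ne) mul0r.
Qed.

End Decomposition.

(** * Submodules fixed by every automorphism over [A_d] *)

Section InvariantSubmodules.
Context (F : closedFieldType) (n k : nat) (d : 'I_n -> nat).
Context (dF : forall i, (d i)%:R != 0 :> F).
Context (P : set 'rV[laurent F n]_k) (subP : is_submod setT P).
Context (fixP : forall g : {lrmorphism laurent F n -> laurent F n},
                  Aut_fixing (laurent_sub d) g -> submod_act g P = P).

Lemma invariant_sum (I : Type) (r : seq I) (G : I -> 'rV[laurent F n]_k) :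
  (forall i, P (G i)) -> P (\sum_(i <- r) G i).
Proof. by move=> PG; have [P0 PD _] := subP; elim/big_ind: _. Qed.

(* The indicator of a class modulo [d i] is an average of the characters
   [m |-> z ^ m_i] with [z ^+ d i = 1], each of which gives an automorphism. *)
Lemma invariant_congruence_proj i (a : int) v : P v ->
  P (map_mx (multiplier (fun m => (d i %| m 0%R i - a)%Z%:R)) v).
Proof.
move=> Pv; have [z pz] := closed_prim_root_exists (dF i).
have z0 j : z ^+ j != 0.
  by rewrite expf_neq0 // (prim_root_eq0 pz); apply: contra_neq (dF i) => ->.
pose w j (m : 'rV[int]_n) := (z ^+ j) ^ (m 0 i).
have wD j : {morph w j : m1 m2 / m1 + m2 >-> m1 * m2}.
  by move=> m1 m2; rewrite /w mxE expfzDr.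
have wL j m : in_lattice d m -> w j m = 1.
  move=> /forallP/(_ i)/dvdzP[q Dq]; rewrite /w Dq mulrC -exprz_exp -exprnP.
  by rewrite exprAC (prim_expr_order pz) expr1n exp1rz.
have Pw j : P (map_mx (multiplier (w j)) v).
  have [||g bij_g gE] := @multiplier_automorphism F n (w j);
    rewrite ?wL ?in_lattice0 //.
  (* Invariance replaces [P] by [g(P)], which visibly contains the image of [v]. *)
  rewrite -(fixP (g := g)); last first.
    by split=> // b Bb; rewrite gE (multiplier_fixes (wL j)).
  by exists v => //; apply: eq_map_mx.
(* Discrete Fourier inversion: the average over [j] of [(z ^+ j) ^ (m 0 i - a)] is the indicator.
   The coefficients are embedded in [A] because [P] is an [A]-module. *)
have -> : map_mx (multiplier (fun m => (d i %| m 0%R i - a)%Z%:R)) v =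
    \sum_(j < d i) ((d i)%:R^-1 * (z ^+ j) ^ (- a))%:A *:
      map_mx (multiplier (w j)) v.
  apply/rowP => l; apply/laurent_coeffP => m; rewrite summxE raddf_sum !mxE /=.
  under eq_bigr do rewrite !mxE mulr_algl linearZ /= coeff_multiplier mulrA
    -mulrA -mulrA (mulrA (_ ^ _)) -expfzDr // (addrC (- a)).
  rewrite coeff_multiplier -mulr_sumr -mulr_suml (sum_prim_exprz _ pz).
  by case: (_ %| _)%Z; rewrite ?(mul0r, mulr0) // mul1r mulKf.
by apply: invariant_sum => j; have [_ _ PZ] := subP; apply: PZ.
Qed.

(** The indicator of [c + L_d] is the product over [i] of the one-coordinate congruence indicators,
    so the projection is built one coordinate at a time. *)
Lemma invariant_lattice_proj c v : P v -> P (map_mx (@lattice_proj F n d c) v).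
Proof.
move=> Pv.
pose D s (m : 'rV[int]_n) :=
  all (fun i => (d i %| m 0%R i - c 0%R i)%Z) s.
suff /(_ (enum 'I_n)) : forall s,
    P (map_mx (multiplier (fun m => (D s m)%:R)) v).
  congr (P _); apply: eq_map_mx => f; apply/laurent_coeffP => m.
  rewrite !coeff_multiplier.
  congr (_%:R * _); congr nat_of_bool.
  apply/allP/forallP => L i; first by rewrite !mxE L // mem_enum.
  by move=> _; have := L i; rewrite !mxE.
elim=> [|i s IHs].
  by congr (P _): Pv; apply/rowP => j; apply/laurent_coeffP => m;
    rewrite mxE coeff_multiplier mul1r.
have := invariant_congruence_proj i (c 0 i) IHs; congr (P _).
apply/rowP => j; apply/laurent_coeffP => m; rewrite !mxE.
by rewrite !coeff_multiplier mulrA -natrM mulnb.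
Qed.

Lemma invariant_sub_extension :
  P `<=` extension (P `&` free_mod (laurent_sub d)).
Proof.
move=> v Pv; have [r ->] := sum_lattice_proj d v.
have [E0 ED EZ] := extension_submod (P `&` free_mod (laurent_sub d)).
elim/big_ind: _ => // c _.
have unit_c : laurent_monomial F c * laurent_monomial F (- c) = 1.
  by rewrite -laurent_monomialD subrr.
(* The factor with exponent [c] stays outside as a scalar; the other one moves the support of [v_c]
   into [L_d]. *)
rewrite -[map_mx _ v]scale1r -unit_c -scalerA; apply: EZ => //.
apply: sub_extension; split.
  by have [_ _ PZ] := subP; apply/PZ/invariant_lattice_proj.
move=> j; apply: laurent_sub_supported => m; rewrite !mxE.
rewrite laurent_monomialE coeff_mul_term
  coeff_multiplier opprK addrK mul1r.
by case: (in_lattice d m) => //; rewrite mul0r eqxx.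
Qed.

End InvariantSubmodules.

Theorem lemma5p2 (n k : nat) (hn : (0 < n)%N) (hk : (0 < k)%N)
    (d : 'I_n -> nat) (F : closedFieldType)
    (hF : is_complex_field F \/
          (exists2 p : nat, p \in [pchar F] &
             forall i : 'I_n, d i != 0%N -> coprime p (d i)))
    (Q : set 'rV[laurent F n]_k)
    (hQ : is_submod (laurent_sub d) Q)
    (hQd : Q `<=` free_mod (laurent_sub d)) :
  (forall (g : {lrmorphism laurent F n -> laurent F n})
          (P : set 'rV[laurent F n]_k),
     Aut_fixing (laurent_sub d) g ->
     contracts_to (laurent_sub d) Q P ->
     contracts_to (laurent_sub d) Q (submod_act g P)) /\
  ((forall i : 'I_n, (0 < d i)%N) ->
   [set P | contracts_to (laurent_sub d) Q P /\
            forall g : {lrmorphism laurent F n -> laurent F n},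
              Aut_fixing (laurent_sub d) g -> submod_act g P = P] =
   [set extension Q]).
Proof.
split=> [g P Ag CP|d_gt0]; first exact: submod_act_contracts.
(* In characteristic zero positivity suffices; in characteristic [p], coprimality says that [p] does
   not divide [d i]. *)
have dF i : (d i)%:R != 0 :> F.
  case: hF => [[R [f bij_f]]|[p pF /(_ i)]].
    by rewrite -(rmorph_nat f) fmorph_eq0 pnatr_eq0 -lt0n.
  rewrite -lt0n -(dvdn_pcharf pF) => /(_ (d_gt0 i)).
  by rewrite prime_coprime // (pcharf_prime pF).
apply/seteqP; split=> [P [[subP PQ] fixP]|_ ->] /=; last first.
  split; last by move=> g; apply: submod_act_extension.
  apply: (extension_contracts (pi := @lattice_proj F n d 0)) => //.
  - exact: lattice_proj_sub.
  - exact: lattice_proj_id.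
  - by move=> a b; apply: lattice_projM.
(* Invariance of [P] gives the inclusion in [extension Q]; the reverse one holds because [P] is a
   submodule containing [Q]. *)
apply/seteqP; split; first by rewrite -PQ; apply: invariant_sub_extension.
by apply: extension_sub => // v; rewrite -PQ => -[].
Qed.
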